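(* Let $\alpha>0$ and $S\in(0,\alpha)$. Assume that $u\in N_\alpha$ is such that $$\max_{x\in[-1,1]}|u'(x)|\ge S .$$ Then $$W(u)>\pi(\alpha-S)\,G(S)^2 .$$ Equivalently, for $u\in N_\alpha$, $$W(u)\le\pi(\alpha-S)\,G(S)^2\quad\Rightarrow\quad\max_{x\in[-1,1]}|u'(x)|<S .$$
   Context: The set $N_\alpha$ is $$N_\alpha=\{v\in H^2((-1,1);(0,\infty))\mid v(1)=v(-1)=\alpha,\ v'(1)=v'(-1)=0,\ v(x)=v(-x)\ \text{for all }x\in[-1,1]\}.$$ The Willmore functional of the surface of revolution obtained by rotating the graph of $v$ around the $x$-axis is $$W(v)=\frac{\pi}{2}\int_{-1}^1\left(\frac{1}{v(x)\sqrt{1+v'(x)^2}}-\frac{v''(x)}{(1+v'(x)^2)^{3/2}}\right)^2v(x)\sqrt{1+v'(x)^2}\,dx .$$ The function $G$ is $G(t)=\int_0^t\frac{d\tau}{(1+\tau^2)^{5/4}}$ for $t\in\mathbb R$. *)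

(* Defs.v *)
From HB Require Import structures.
From mathcomp Require Import all_boot all_order all_algebra.
From mathcomp Require Import all_classical all_reals all_analysis.

Set Implicit Arguments.
Unset Strict Implicit.
Unset Printing Implicit Defensive.

Import Order.TTheory GRing.Theory Num.Theory.
Import numFieldNormedType.Exports.

Local Open Scope classical_set_scope.
Local Open Scope ring_scope.

(* C_c^oo(-1, 1), each function being extended by zero to the whole line. *)
Definition test_function (R : realType) (phi : R -> R) : Prop :=
  [/\ forall (n : nat) (x : R), derivable (derive1n n phi) x 1,
      compact (closure [set x | phi x != 0]) &
      closure [set x | phi x != 0] `<=` `]-1, 1[].

Definition L2_function (R : realType) (f : R -> R) : Prop :=
  measurable_fun (`]-1, 1[%classic : set R) f /\
  (@lebesgue_measure R).-integrable `]-1, 1[ (fun x => (f x ^+ 2)%:E).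

Definition weak_derivative (R : realType) (f g : R -> R) : Prop :=
  forall phi : R -> R, test_function phi ->
    Rintegral (@lebesgue_measure R) `]-1, 1[ (fun x => f x * derive1 phi x) =
    - Rintegral (@lebesgue_measure R) `]-1, 1[ (fun x => g x * phi x).

(* An element of H^2(-1, 1).  As H^2(-1, 1) embeds into C^1([-1, 1]), it is
   given by the representatives of itself and of its first weak derivative that
   are continuous up to the boundary, so that boundary values and maxima over
   [-1, 1] make sense; the second weak derivative is given by an arbitrary
   representative.  Values outside [-1, 1] are irrelevant. *)
Record H2 (R : realType) := MkH2 {
  H2_fun :> R -> R;
  H2_d1 : R -> R;
  H2_d2 : R -> R;
  H2_fun_L2 : L2_function H2_fun;
  H2_d1_L2 : L2_function H2_d1;
  H2_d2_L2 : L2_function H2_d2;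
  H2_fun_weak : weak_derivative H2_fun H2_d1;
  H2_d1_weak : weak_derivative H2_d1 H2_d2;
  H2_fun_cont : {within `[-1, 1], continuous H2_fun};
  H2_d1_cont : {within `[-1, 1], continuous H2_d1}
}.

Definition N (R : realType) (alpha : R) (v : H2 R) : Prop :=
  [/\ forall x : R, x \in `]-1, 1[ -> 0 < v x,
      v 1 = alpha /\ v (-1) = alpha,
      H2_d1 v 1 = 0 /\ H2_d1 v (-1) = 0 &
      forall x : R, x \in `[-1, 1] -> v x = v (- x)].

(* Extended-real valued: the integrand is nonnegative for v in N alpha. *)
Definition W (R : realType) (v : H2 R) : \bar R :=
  ((pi / 2)%:E *
   \int[@lebesgue_measure R]_(x in `[(-1)%R, 1%R])
     ((1 / (v x * Num.sqrt (1 + H2_d1 v x ^+ 2))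
       - H2_d2 v x / (1 + H2_d1 v x ^+ 2) `^ (3 / 2)) ^+ 2
      * v x * Num.sqrt (1 + H2_d1 v x ^+ 2))%:E)%E.

Definition G (R : realType) (t : R) : R :=
  let g (tau : R) := 1 / (1 + tau ^+ 2) `^ (5 / 4) in
  if 0 <= t then Rintegral (@lebesgue_measure R) `[0, t] g
  else - Rintegral (@lebesgue_measure R) `[t, 0] g.

Definition max_abs_d1 (R : realType) (v : H2 R) : R :=
  sup [set `|H2_d1 v x| | x in `[-1, 1]].

Lemma max_abs_d1_attained (R : realType) (v : H2 R) :
  (exists2 x, x \in `[-1, 1] & `|H2_d1 v x| = max_abs_d1 v) /\
  (forall x, x \in `[-1, 1] -> `|H2_d1 v x| <= max_abs_d1 v).
Proof.
have h11 : (-1 : R) <= 1 by rewrite (le_trans _ ler01)// lerN10.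
have cf : {within `[-1, 1], continuous (fun x => `|H2_d1 v x|)}.
  by move=> x; apply: cvg_norm; exact: (@H2_d1_cont R v x).
have [c cI cmax] := EVT_max h11 cf.
have supE : max_abs_d1 v = `|H2_d1 v c|.
  apply/eqP; rewrite eq_le; apply/andP; split.
    apply: ge_sup; first by exists `|H2_d1 v c|, c.
    by move=> _ [x xI <-]; exact: cmax.
  apply: ub_le_sup; last by exists c.
  by exists `|H2_d1 v c| => _ [x xI <-]; exact: cmax.
by split; [exists c | move=> x xI; rewrite supE; exact: cmax].
Qed.

(* Main.v *)
(* Expanding the square in W turns the mixed term into an exact derivative of a
   function of u', whose integral vanishes because u'(-1) = u'(1) = 0.  What
   remains is the integral of 1 / (u sqrt(1 + u'^2)) + u ((G o u')')^2.  Let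
   x1 > 0 be the largest point with |u'(x1)| = S.  On [x1, 1] one has |u'| <= S,
   hence u >= alpha - S, and the integral of (G o u')' over [x1, 1] is
   - G(u'(x1)) = +- G(S); since 1 - x1 <= 1 the Cauchy-Schwarz inequality gives
   (alpha - S) G(S)^2 there.  The interval [-1, -x1] contributes the same by
   symmetry, and the first term makes the inequality strict. *)
Require Import Defs.
From mathcomp Require Import all_boot all_order all_algebra.
From mathcomp Require Import all_classical all_reals all_analysis.
From mathcomp Require Import measurable_realfun ring lra.
Import Order.TTheory GRing.Theory Num.Theory.
Import numFieldNormedType.Exports.
Local Open Scope classical_set_scope.
Local Open Scope ring_scope.
Set Implicit Arguments.
Unset Strict Implicit.

(** * Smooth step functions *)

Section Smooth.
Context {R : realType}.
Implicit Types f g df : R -> R.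

(** Since [u''] is only a square-integrable weak derivative, classical calculus does not apply to
    functions of [u']. Two facts replace it: a weak derivative integrates to differences, obtained
    from test functions that are differences of smooth steps, hence the construction built on
    [exp (-1/x)]; and the chain rule for [H o u'] with [H] of class C^1. The exponent 5/4 is half of
    the 5/2 with which [1 + u'^2] divides [u''^2] in the expanded integrand. The exact derivative is
    that of [t / sqrt (1 + t^2)] at [t = u'], with kernel [(1 + t^2)^(-3/2)]. That [x1] is positive
    comes from symmetry: [u] is even, so [u'] is odd and vanishes at 0. Strictness is quantitative:
    by compactness the first term stays above some [m > 0] on [-1, 1]. *)

Fixpoint Ck (n : nat) f : Prop :=
  if n is m.+1 then (forall x : R, derivable f x 1) /\ Ck m (derive1 f)
  else True.

(** [Ck n] does not ask the last derivative to be continuous; quantifying over all [n] recovers the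
    usual notion. *)
Definition smooth f := forall n, Ck n f.

Lemma derive1_ext f df : (forall x : R, is_derive x 1 f (df x)) ->
  derive1 f = df.
Proof. by move=> h; apply/funext => x; rewrite derive1E; apply: derive_val. Qed.

Lemma is_derive_derive1 f (x : R) : derivable f x 1 ->
  is_derive x 1 f (derive1 f x).
Proof. by move=> h; rewrite derive1E; apply: DeriveDef. Qed.

Lemma CkS n f df : (forall x : R, is_derive x 1 f (df x)) -> Ck n df ->
  Ck n.+1 f.
Proof.
by move=> h c; split; [move=> x; exact: ex_derive|rewrite (derive1_ext h)].
Qed.

Lemma CkW n f : Ck n.+1 f -> Ck n f.
Proof.
elim: n f => // n IH f [df cf]; split=> //; exact: IH.
Qed.

Lemma CkD n f g : Ck n f -> Ck n g -> Ck n (fun x => f x + g x).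
Proof.
elim: n f g => // n IH f g [df cf] [dg cg].
apply: (@CkS _ _ (fun x => derive1 f x + derive1 g x)); last exact: IH.
by move=> x; apply: is_deriveD; exact: is_derive_derive1.
Qed.

Lemma CkM n f g : Ck n f -> Ck n g -> Ck n (fun x => f x * g x).
Proof.
elim: n f g => // n IH f g Cf Cg; have [df cf] := Cf; have [dg cg] := Cg.
apply: (@CkS _ _ (fun x => f x * derive1 g x + g x * derive1 f x)).
  move=> x.
  have h1 := is_derive_derive1 (df x); have h2 := is_derive_derive1 (dg x).
  exact: (is_deriveM h1 h2).
by apply: CkD; apply: IH => //; exact: CkW.
Qed.

Lemma Ck_cst n (c : R) : Ck n (fun=> c).
Proof.
elim: n c => // n IH c; exact: (CkS (df:=fun=> 0) (fun x => is_derive_cst c x 1)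
  (IH 0)).
Qed.

Lemma Ck_affine n f (a b : R) : Ck n f -> Ck n (fun x => f (a * x + b)).
Proof.
elim: n f => // n IH f [df cf].
apply: (@CkS _ _ (fun x => a * derive1 f (a * x + b))); last first.
  by apply: CkM; [exact: Ck_cst|exact: IH].
move=> x.
have h : is_derive x 1 (fun x => a * x + b) a.
  by apply: is_derive_eq; rewrite /GRing.scale/= mulr1 ?mulr0 ?addr0.
have h2 := is_derive_derive1 (df (a * x + b)).
by apply: is_derive_eq; rewrite mulrC.
Qed.

Lemma smooth_derivable f n (x : R) : smooth f -> derivable (derive1n n f) x 1.
Proof.
move=> /(_ n.+1); elim: n f => [|n IH] f [df cf]; first exact: df.
by rewrite /derive1n iterSr; exact: IH.
Qed.

(** The powers of [x^-1] are there to make the family closed under differentiation: each derivative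
    is a combination of members of higher index. *)
Definition flat (n : nat) (x : R) : R :=
  if 0 < x then x^-1 ^+ n * expR (- x^-1) else 0.

(** With [y = x^-1] and [m = n + 2], raising [y / m <= exp (y / m)] to the power [m] gives
    [(y / m)^m <= exp y]. The two extra powers leave [x^2], enough for a zero derivative at 0. *)
Lemma flat_bound n : exists2 C : R, 0 <= C
  & forall x, `|flat n x| <= C * x ^+ 2.
Proof.
pose m := n.+1.+1; exists (m%:R ^+ m) => [|x]; first by rewrite exprn_ge0.
rewrite /flat; case: ifPn => x0; last
  by rewrite normr0 mulr_ge0 ?sqr_ge0// exprn_ge0.
have y0 : 0 < x^-1 by rewrite invr_gt0.
have y0W := ltW y0; rewrite ger0_norm ?mulr_ge0 ?exprn_ge0 ?expR_ge0//.
rewrite expRN ler_pdivrMr ?expR_gt0//.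
have h : (x^-1 / m%:R) ^+ m <= expR x^-1.
  have -> : expR x^-1 = expR (x^-1 / m%:R) ^+ m.
    by rewrite -expRM_natr divfK// pnatr_eq0.
  rewrite lerXn2r ?nnegrE ?expR_ge0 ?divr_ge0//.
  by apply: le_trans (expR_ge1Dx _); rewrite lerDr.
have -> : x^-1 ^+ n = m%:R ^+ m * x ^+ 2 * (x^-1 / m%:R) ^+ m.
  have M0 : (m%:R : R) ^+ m != 0 by rewrite expf_neq0// pnatr_eq0.
  have x2 : x ^+ 2 != 0 by rewrite expf_neq0// gt_eqF.
  have xm : x^-1 ^+ m = x^-1 ^+ n * (x ^+ 2)^-1 by rewrite -exprVn -exprD addn2.
  rewrite exprMn [m%:R^-1 ^+ m]exprVn xm.
  move: (x^-1 ^+ n) M0 x2 => y.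
  by move: (m%:R ^+ m) (x ^+ 2) => a b a0 b0; field; rewrite a0 b0.
by apply: ler_wpM2l h; rewrite mulr_ge0 ?exprn_ge0// ltW.
Qed.

Lemma is_derive_sq_bound f (C : R) :
  (forall x, `|f x| <= C * x ^+ 2) -> is_derive (0:R) 1 f 0.
Proof.
move=> fC; have f0 : f 0 = 0.
  by apply/eqP; rewrite -normr_le0 (le_trans (fC 0))// expr0n mulr0.
(* Division by zero yields 0, so this quotient already takes at [z = 0] the value of the derivative
   sought. *)
apply/is_derive1_caratheodory; exists (fun z => f z / z); split => [z||].
- have [->|z0] := eqVneq z 0; first by rewrite f0 subrr mulr0.
  by rewrite f0 !subr0 divfK.
- have C0 : 0 <= C by have := fC 1; rewrite expr1n mulr1; exact: le_trans.
  rewrite /prop_for /continuous_at f0 mul0r.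
  suff : f z / z @[z --> (0 : R)] --> (0 : R) by [].
  apply/cvgr0Pnorm_lt => e e0.
  have d0 : 0 < e / (C + 1) by rewrite divr_gt0// ltr_wpDl.
  near=> z.
  have zd : `|z| < e / (C + 1).
    by near: z; exact: (@nbhs0_lt _ R _ d0).
  have [->|z0] := eqVneq z 0; first by rewrite f0 mul0r normr0.
  rewrite normrM normfV ltr_pdivrMr ?normr_gt0//.
  apply: le_lt_trans (fC z) _; rewrite -real_normK ?num_real// expr2 mulrA.
  rewrite ltr_pM2r ?normr_gt0//.
  move: zd; rewrite ltr_pdivlMr ?ltr_wpDl// => zd.
  apply: le_lt_trans zd; rewrite mulrC ler_wpM2l// lerDl//.
- by rewrite f0 mul0r.
Unshelve. all: by end_near. Qed.

Lemma is_derive_flat n (x : R) :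
  is_derive x 1 (flat n) (flat n.+2 x - n%:R * flat n.+1 x).
Proof.
have [x0|x0|->] := ltgtP x 0.
- have -> : flat n.+2 x - n%:R * flat n.+1 x = 0.
    by rewrite /flat ltNge (ltW x0)/= mulr0 subr0.
  apply: (@near_eq_is_derive _ _ _ (cst 0)) => //.
  near=> y; rewrite /flat ltNge ltW//.
  by near: y; exact: lt_nbhsl.
- have -> : flat n.+2 x - n%:R * flat n.+1 x =
     x^-1 ^+ n * (expR (- x^-1) * x^-1 ^+ 2) +
     expR (- x^-1) * (n%:R * x^-1 ^+ n.-1 * - x^-1 ^+ 2).
    rewrite /flat x0; case: n => [|n]/=.
      by rewrite !mul0r !mulr0 subr0 addr0 expr0 mul1r mulrC.
    rewrite !exprS; ring.
  apply: (@near_eq_is_derive _ _ _ (fun y : R => y^-1 ^+ n * expR (- y^-1))).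
    near=> y; rewrite /flat ifT//.
    by near: y; exact: lt_nbhsr.
  have xn0 : x != 0 by rewrite gt_eqF.
  have h1 : is_derive x 1 (fun y : R => y^-1) (- x^-1 ^+ 2).
    by have := is_deriveV xn0 (is_derive_id x 1);
      rewrite /GRing.scale/= mulr1 -exprVn.
  have h2 : is_derive x 1 (fun y : R => y^-1 ^+ n)
    (n%:R * x^-1 ^+ n.-1 * - x^-1 ^+ 2).
    by have := is_deriveX n h1; rewrite exprfctE.
  have h3 : is_derive x 1 (fun y : R => expR (- y^-1))
    (expR (- x^-1) * x^-1 ^+ 2).
    have := is_derive1_comp (is_derive_expR _) (is_deriveN h1); rewrite opprK;
      exact.
  exact: (is_deriveM h2 h3).
- have -> : flat n.+2 0 - n%:R * flat n.+1 0 = 0.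
    by rewrite /flat ltxx mulr0 subr0.
  by have [C _ h] := flat_bound n; exact: is_derive_sq_bound h.
Unshelve. all: by end_near. Qed.

(** The induction on [k] must keep [n] general, because differentiating raises the index. *)
Lemma Ck_flat k n : Ck k (flat n).
Proof.
elim: k n => // k IH n.
apply: CkS (@is_derive_flat n) _.
apply: CkD; first exact: IH.
rewrite (_ : (fun _ => _) = (fun x => - n%:R * flat n.+1 x)).
  by apply: CkM; [exact: Ck_cst|exact: IH].
by apply/funext => x; rewrite mulNr.
Qed.

Definition smooth_bump (x : R) := flat 0 x * flat 0 (1 - x).

Lemma Ck_smooth_bump k : Ck k smooth_bump.
Proof.
apply: CkM; first exact: Ck_flat.
rewrite (_ : (fun _ => _) = (fun x => flat 0 (-1 * x + 1))).
  exact/Ck_affine/Ck_flat.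
by apply/funext => x; rewrite mulN1r addrC.
Qed.

Lemma flat_ge0 n x : 0 <= flat n x.
Proof.
rewrite /flat; case: ifPn => // x0.
by rewrite mulr_ge0 ?expR_ge0// exprn_ge0// invr_ge0 ltW.
Qed.

Lemma smooth_bump_ge0 x : 0 <= smooth_bump x.
Proof. by rewrite mulr_ge0// flat_ge0. Qed.

Lemma smooth_bump_gt0 x : 0 < x < 1 -> 0 < smooth_bump x.
Proof.
by move=> /andP[x0 x1]; rewrite /smooth_bump /flat subr_gt0 x0 x1 !expr0 !mul1r
  mulr_gt0// expR_gt0.
Qed.

Lemma smooth_bump_out x : ~~ (0 < x < 1) -> smooth_bump x = 0.
Proof.
rewrite /smooth_bump /flat subr_gt0 negb_and => /orP[]/negbTE->;
  by rewrite ?mul0r ?mulr0.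
Qed.

End Smooth.

(** * Primitives of continuous functions and the smooth step *)

Section Primitive.
Context {R : realType}.
Implicit Types f g df K : R -> R.
Notation mu := (@lebesgue_measure R).

Lemma is_derive_continuous f df : (forall x : R, is_derive x 1 f (df x)) ->
  continuous f.
Proof.
by move=> h x; apply/differentiable_continuous/derivable1_diffP/ex_derive.
Qed.

Lemma mean_value f df (x y : R) : (forall z : R, is_derive z 1 f (df z)) ->
  x < y -> exists2 c, x < c < y & f y - f x = df c * (y - x).
Proof.
move=> h xy; have [|c] := MVT xy (fun z _ => h z).
  exact/continuous_subspaceT/(is_derive_continuous h).
by rewrite in_itv/=; exists c.
Qed.

Lemma continuous_integrable K (a b : R) : continuous K ->
  mu.-integrable `[a, b] (EFin \o K).
Proof.
move=> cK; apply: continuous_compact_integrable; first exact: segment_compact.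
exact: continuous_subspaceT.
Qed.

(** The case split copies that of [G], so that [G] is an instance by unfolding alone. *)
Definition primitive K (t : R) : R :=
  if 0 <= t then Rintegral mu `[0, t] K else - Rintegral mu `[t, 0] K.

(** Basing the integral at a point left of both 0 and [y] removes the case split on the sign of [y],
    which would obstruct differentiation at 0. *)
Lemma primitiveE K (a y : R) : continuous K -> a <= y -> a <= 0 ->
  primitive K y = Rintegral mu `[a, y] K - Rintegral mu `[a, 0] K.
Proof.
move=> cK ay a0; have iK := fun x y => @continuous_integrable K x y cK.
have oc (x z : R) : Rintegral mu `]x, z] K = Rintegral mu `[x, z] K.
  apply: Rintegral_itv_obnd_cbnd; apply: integrableS (iK x z) => //.
  exact: subset_itv_oc_cc.
rewrite /primitive; case: ifPn => [y0|].
  by rewrite Rintegral_itvB ?oc.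
rewrite -ltNge => /ltW y0; rewrite -[RHS]opprB; congr (- _).
by rewrite Rintegral_itvB ?oc.
Qed.

Lemma is_derive_primitive K : continuous K ->
  forall x : R, is_derive x 1 (primitive K) (K x).
Proof.
move=> cK x; pose a := Num.min x 0 - 1.
have ax : a < x by rewrite /a ltrBlDr gt_min ltrDl ltr01.
have a0 : a <= 0 by rewrite /a lerBlDr ge_min [X in _ || X]lerDl ler01 orbT.
have x1 : x < x + 1 by rewrite ltrDl.
have [d1 d2] := continuous_FTC1_closed x1
  (continuous_integrable a (x + 1) cK) ax (cK x).
apply: (@near_eq_is_derive _ _ _ (fun y => Rintegral mu `[a, y] K -
  Rintegral mu `[a, 0] K)).
  near=> y; rewrite (@primitiveE K a)//.
  by apply/ltW; near: y; exact: lt_nbhsr.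
rewrite -[K x]subr0 -d2; apply: is_deriveB; exact: is_derive_derive1.
Unshelve. all: by end_near. Qed.

Lemma derive0_const f : (forall x : R, is_derive x 1 f 0) ->
  forall x y, f x = f y.
Proof.
move=> h x y; wlog xy : x y / x < y.
  by move=> H; have [/H//|/H->//|->//] := ltgtP x y.
have [c _] := mean_value h xy.
by rewrite mul0r => /eqP; rewrite subr_eq0 => /eqP.
Qed.

(** [s] is the primitive of the bump divided by its total mass [c]. Its derivative [rho] is thus a
    nonnegative kernel of mass 1 carried by ]0, 1[, later rescaled into a mollifier. *)
Lemma smooth_step_exists : exists (s rho : R -> R),
  [/\ smooth s, forall x : R, is_derive x 1 s (rho x), continuous rho,
     forall x, 0 <= rho x & forall x, ~~ (0 < x < 1) -> rho x = 0] /\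
  [/\ forall x, x <= 0 -> s x = 0, forall x, 1 <= x -> s x = 1 &
     forall x, 0 <= s x <= 1].
Proof.
have cb : continuous (@smooth_bump R).
  have [h _] := @Ck_smooth_bump R 1.
  by move=> x; apply/differentiable_continuous/derivable1_diffP.
have dP := is_derive_primitive cb.
have B0 : primitive smooth_bump 0 = 0 by rewrite /primitive lexx set_itv1
  Rintegral_set1.
set B := primitive smooth_bump in dP B0; pose c := B 1.
have c0 : 0 < c.
  have [z z01] := mean_value dP (@ltr01 R); rewrite subr0 mulr1 B0 subr0 => h.
  by rewrite /c h smooth_bump_gt0.
have cn0 : c != 0 by rewrite gt_eqF.
have Bmono x y : x <= y -> B x <= B y.
  rewrite le_eqVlt => /predU1P[->//|xy].
  have [z _ h] := mean_value dP xy.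
  by rewrite -subr_ge0 h mulr_ge0 ?smooth_bump_ge0// subr_ge0 ltW.
have Bl x : x <= 0 -> B x = 0.
  rewrite le_eqVlt => /predU1P[->//|xy].
  have [z /andP[_ z0]] := mean_value dP xy.
  rewrite smooth_bump_out ?mul0r; last by rewrite ltNge (ltW z0).
  by rewrite B0 sub0r => /eqP; rewrite oppr_eq0 => /eqP.
have Br x : 1 <= x -> B x = c.
  rewrite le_eqVlt => /predU1P[<-//|xy].
  have [z /andP[z0 _]] := mean_value dP xy.
  rewrite smooth_bump_out ?mul0r; last by rewrite andbC ltNge (ltW z0).
  by move=> /eqP; rewrite subr_eq0 => /eqP.
have ds (x : R) : is_derive x 1 (fun x => c^-1 * B x) (c^-1 * smooth_bump x).
  exact: (is_deriveZ c^-1 (dP x)).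
exists (fun x => c^-1 * B x), (fun x => c^-1 * smooth_bump x); split;
  split => //.
- case=> [//|n]; apply: (CkS ds); apply: CkM;
  [exact: Ck_cst|exact: Ck_smooth_bump].
- by move=> x; apply: cvgM; [exact: cvg_cst|exact: cb].
- by move=> x; rewrite mulr_ge0 ?smooth_bump_ge0// invr_ge0 ltW.
- by move=> x /smooth_bump_out ->; rewrite mulr0.
- by move=> x /Bl ->; rewrite mulr0.
- by move=> x /Br ->; rewrite mulVf.
move=> x; have [x0|/ltW x0] := leP x 0; first by rewrite Bl// mulr0 lexx ler01.
rewrite mulr_ge0 ?invr_ge0 ?(ltW c0)//=; last by rewrite -B0 Bmono.
rewrite mulrC ler_pdivrMr// mul1r.
have [x1|/ltW x1] := leP x 1; first exact: Bmono.
by rewrite Br.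
Qed.

End Primitive.

(** * Limits and integrals *)

Section Integrals.
Context {R : realType}.
Implicit Types f g df K : R -> R.
Notation mu := (@lebesgue_measure R).

(** The extension is [f] composed with the clamping map onto [a, b]. It takes only values of [f], so
    positivity on [a, b] passes to the whole line. *)
Lemma continuous_extension f (a b : R) :
  a <= b -> {within `[a, b], continuous f} ->
  exists h : R -> R, [/\ continuous h, forall x, x \in `[a, b] -> h x = f x &
    forall x, exists2 y, y \in `[a, b] & h x = f y].
Proof.
move=> ab /subspace_continuousP cf.
pose cl (x : R) := Num.max a (Num.min b x).
have clI x : `[a, b]%classic (cl x).
  by rewrite /= in_itv/= /cl le_max lexx/= ge_max ab ge_min lexx.
have ccl : continuous cl.
  move=> x; apply: continuous_max; first exact: cvg_cst.
  by apply: continuous_min; [exact: cvg_cst|exact: cvg_id].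
exists (f \o cl); split => [x|x|x]; [| |exists (cl x); [exact: clI|by []]];
  last first.
  by rewrite in_itv/= => /andP[ax xb]; rewrite /= /cl min_r// max_r.
have h : cl @ x --> within `[a, b] (nbhs (cl x)).
  move=> P; rewrite /within/= => hP.
  have hh : \forall y \near x, `[a, b]%classic (cl y) -> P (cl y) := ccl x _ hP.
  suff : \forall y \near x, P (cl y) by [].
  by apply: filterS hh => y h; exact: h (clI y).
by apply: cvg_comp h _; exact: cf.
Qed.

Lemma nearoo_ge_mul (c M : R) : 0 < c -> \forall n \near \oo, M <= n.+1%:R * c.
Proof.
move=> c0; near=> n; rewrite -ler_pdivrMr//.
apply: (@le_trans _ _ n%:R); last by rewrite ler_nat.
by near: n; exact: nbhs_infty_ger.
Unshelve. all: by end_near. Qed.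

Lemma Rintegral_itvoo_cc (f : R -> R) (a b : R) :
  mu.-integrable `[a, b] (EFin \o f) ->
  Rintegral mu `]a, b[ f = Rintegral mu `[a, b] f.
Proof.
move=> fi; rewrite Rintegral_itv_obnd_cbnd; last first.
  by apply: integrableS fi => //; exact: subset_itv_oo_cc.
rewrite Rintegral_itv_bndo_bndc//.
by apply: integrableS fi => //; exact: subset_itv_co_cc.
Qed.

Lemma Rintegral_dominated (D : set R) (f_ : nat -> R -> R) f g :
  measurable D -> (forall n, measurable_fun D (f_ n)) -> measurable_fun D f ->
  (forall x, D x -> f_ ^~ x @ \oo --> f x) ->
  mu.-integrable D (EFin \o g) ->
  (forall x n, D x -> `|f_ n x| <= g x) ->
  Rintegral mu D (f_ n) @[n --> \oo] --> Rintegral mu D f.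
Proof.
move=> mD mf_ mf cf ig fg.
have [||||fi _ H] := @dominated_convergence _ _ R mu D mD
  (fun n => EFin \o f_ n) (EFin \o f) (EFin \o g) _ _ _ ig.
- by move=> n; apply/measurable_EFinP; exact: mf_.
- exact/measurable_EFinP.
- by apply: aeW => x Dx; apply: cvg_EFin; [exact: nearW|exact: cf].
- by apply: aeW => x n Dx; rewrite lee_fin fg.
apply: fine_cvg; rewrite fineK//; exact: integrable_fin_num.
Qed.

Lemma FTC2_everywhere f df (a b : R) :
  (forall x : R, is_derive x 1 f (df x)) -> continuous df ->
  a < b -> Rintegral mu `[a, b] df = f b - f a.
Proof.
move=> h cdf ab; rewrite /Rintegral (@continuous_FTC2 _ _ f)//.
- exact: continuous_subspaceT.
- have cf := is_derive_continuous h; split => //.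
  + exact/cvg_at_right_filter/cf.
  + exact/cvg_at_left_filter/cf.
- by move=> x _; rewrite (derive1_ext h).
Qed.

End Integrals.

(** * Integrating weak derivatives *)

Section Mollifier.
Context {R : realType}.
Implicit Types f g df K : R -> R.
Notation mu := (@lebesgue_measure R).
Variables (s rho : R -> R).
Hypothesis (ss : smooth s) (ds : forall x : R, is_derive x 1 s (rho x))
  (crho : continuous rho) (rho_ge0 : forall x, 0 <= rho x)
  (rho_out : forall x, ~~ (0 < x < 1) -> rho x = 0)
  (s0 : forall x, x <= 0 -> s x = 0) (s1 : forall x, 1 <= x -> s x = 1).

(** The preimage of ]0, 1[ is a window of width [1 / N] near [c]; [k] places it on a chosen side:
    [k = -1] strictly to the right of [c], [k = 2] strictly to the left. *)
Definition zoom (N c k x : R) := N * (x - c) + k.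

Lemma zoom_affine N c k : zoom N c k = fun x => N * x + (k - N * c).
Proof. by apply/funext => x; rewrite /zoom; ring. Qed.

Lemma smooth_zoom N c k : smooth (fun x => s (zoom N c k x)).
Proof. by move=> n; rewrite zoom_affine; apply: Ck_affine. Qed.

Lemma is_derive_zoom N c k (x : R) :
  is_derive x 1 (fun x => s (zoom N c k x)) (N * rho (zoom N c k x)).
Proof.
have h : is_derive x 1 (zoom N c k) N.
  have := is_deriveD (is_deriveZ N (is_derive_id x (1 : R)))
    (is_derive_cst (k - N * c) x (1 : R)).
  by rewrite zoom_affine /GRing.scale/= mulr1 addr0.
by have := is_derive1_comp (ds (zoom N c k x)) h; rewrite mulrC.
Qed.

Lemma continuous_zoom N c k : continuous (zoom N c k).
Proof.
move=> x; apply: cvgD; last exact: cvg_cst.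
by apply: cvgM; [exact: cvg_cst|apply: cvgB; [exact: cvg_id|exact: cvg_cst]].
Qed.

Lemma continuous_mollifier N c k : continuous (fun x => N * rho (zoom N c k x)).
Proof.
move=> x; apply: cvgM; first exact: cvg_cst.
apply: (continuous_comp (@continuous_zoom N c k x)); exact: crho.
Qed.

(** The kernels concentrate at [c], and [hc] says that their window lies in [-1, 1], so that their
    mass there is 1. As the window may be one-sided, [c] can be an endpoint of the interval. *)
Lemma mollify f (c k : R) : continuous f ->
  (\forall n \near \oo,
     zoom n.+1%:R c k (-1) <= 0 /\ 1 <= zoom n.+1%:R c k 1) ->
  Rintegral mu `]-1, 1[ (fun x => f x * (n.+1%:R * rho (zoom n.+1%:R c k x)))
    @[n --> \oo] --> f c.
Proof.
move=> cf hc; apply/cvgrPdist_le => e e0.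
have /cvgrPdist_le/(_ e e0)[d /= d0 hd] := cf c.
near=> n.
have [hc1 hc2] : zoom n.+1%:R c k (-1) <= 0 /\ 1 <= zoom n.+1%:R c k 1.
  by near: n; exact: hc.
(* Where [rho] does not vanish, [N * (c - x)] is [k] minus a number of ]0, 1[, so this puts [x]
   within [d] of [c]. *)
have Nd : `|k| + 2 <= n.+1%:R * d by near: n; exact: nearoo_ge_mul.
have N0 : 0 < n.+1%:R :> R by rewrite ltr0n.
set N : R := n.+1%:R in hc1 hc2 Nd N0 *.
pose psi x := N * rho (zoom N c k x).
have cpsi : continuous psi := @continuous_mollifier N c k.
have Ipsi : Rintegral mu `[-1, 1] psi = 1.
  rewrite (FTC2_everywhere (@is_derive_zoom N c k))//.
  by rewrite s1// s0// subr0.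
have cfpsi : continuous (fun x => f x * psi x).
  by move=> x; apply: cvgM; [exact: cf|exact: cpsi].
have cfp : continuous (fun x => f c * psi x).
  by move=> x; apply: cvgM; [exact: cvg_cst|exact: cpsi].
have cep : continuous (fun x => e * psi x).
  by move=> x; apply: cvgM; [exact: cvg_cst|exact: cpsi].
have cdiff : continuous (fun x => f c * psi x - f x * psi x).
  by move=> x; apply: cvgB; [exact: cfp|exact: cfpsi].
rewrite Rintegral_itvoo_cc; last exact: continuous_integrable.
have -> : f c = Rintegral mu `[-1, 1] (fun x => f c * psi x).
  by rewrite RintegralZl ?Ipsi ?mulr1//; exact: continuous_integrable.
rewrite -RintegralB//; [|exact: continuous_integrable..].
apply: le_trans (le_normr_Rintegral _ _) _ => //;
  first exact: continuous_integrable.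
have -> : e = Rintegral mu `[-1, 1] (fun x => e * psi x).
  by rewrite RintegralZl ?Ipsi ?mulr1//; exact: continuous_integrable.
apply: le_Rintegral => //.
- apply: continuous_integrable => x; apply: cvg_norm; exact: cdiff.
- exact: continuous_integrable.
move=> x _; rewrite -mulrBl normrM [`|psi x|]ger0_norm; last first.
  by rewrite mulr_ge0// ltW.
have [zx|zx] := boolP (0 < zoom N c k x < 1); last first.
  by rewrite /psi rho_out// !mulr0.
apply: ler_wpM2r; first by rewrite mulr_ge0// ltW.
apply: hd => /=; rewrite -(ltr_pM2l N0); apply: lt_le_trans Nd.
rewrite -[N in N * _]gtr0_norm// -normrM.
have -> : N * (c - x) = k - zoom N c k x by rewrite /zoom; ring.
apply: le_lt_trans (ler_normB _ _) _; rewrite ltrD2l.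
by case/andP: zx => z0 z1; rewrite gtr0_norm//; lra.
Unshelve. all: by end_near. Qed.

End Mollifier.

Section WeakDerivative.
Context {R : realType}.
Implicit Types f g df K : R -> R.
Notation mu := (@lebesgue_measure R).

Lemma eventually_cst_cvg (u : nat -> R) (l : R) :
  (\forall n \near \oo, u n = l) -> u n @[n --> \oo] --> l.
Proof.
move=> h; apply/cvgrPdist_le => e e0; near=> n.
have -> : u n = l by near: n.
by rewrite subrr normr0 ltW.
Unshelve. all: by end_near. Qed.

(* The weak derivative is tested against [s (N (x - a) - 1) - s (N (x - b) + 2)]
   for a smooth step s: these functions are supported in [a + 1/N, b - 1/N] and
   converge to the indicator function of ]a, b[. *)
Lemma weak_derivative_FTC_continuous f g (a b : R) : continuous f ->
  mu.-integrable `]-1, 1[ (EFin \o g) -> weak_derivative f g ->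
  -1 <= a -> a < b -> b <= 1 -> Rintegral mu `]a, b[ g = f b - f a.
Proof.
move=> cf ig wfg a1 ab b1.
have [s [rho [[ss ds crho rho_ge0 rho_out] [s0 s1 s01]]]] :=
  @smooth_step_exists R.
pose phi n x := s (zoom n.+1%:R a (-1) x) - s (zoom n.+1%:R b 2 x).
pose dphi n x := n.+1%:R * rho (zoom n.+1%:R a (-1) x) -
  n.+1%:R * rho (zoom n.+1%:R b 2 x).
have dphiE n (x : R) : is_derive x 1 (phi n) (dphi n x).
  by apply: is_deriveB; exact: is_derive_zoom.
(* With 3, both steps are 0 to the left of [a + 1/N] and both are 1 to the right of [b - 1/N], so
   that [phi n] vanishes there. *)
have big3 : \forall n \near \oo, 3 <= n.+1%:R * (b - a).
  by apply: nearoo_ge_mul; rewrite subr_gt0.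
have supp n : 3 <= n.+1%:R * (b - a) ->
    [set x | phi n x != 0] `<=` `[a + n.+1%:R^-1, b - n.+1%:R^-1]%classic.
  move=> n3 x /=; apply: contra_neqT; rewrite in_itv/= negb_and -!ltNge /phi.
  have N0 : 0 < n.+1%:R :> R by rewrite ltr0n.
  set N : R := n.+1%:R in n3 N0 *; have NN : N * N^-1 = 1
    by rewrite divff ?gt_eqF.
  case/orP; rewrite -(ltr_pM2l N0) ?mulrDr ?mulrN NN => h.
    by rewrite !s0 ?subrr// /zoom; lra.
  by rewrite !s1 ?subrr// /zoom; lra.
have test n : 3 <= n.+1%:R * (b - a) -> test_function (phi n).
  move=> n3; have cl : closure [set x | phi n x != 0] `<=`
      `[a + n.+1%:R^-1, b - n.+1%:R^-1]%classic.
    have /closure_id -> : closed `[a + n.+1%:R^-1, b - n.+1%:R^-1]%classic.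
      exact: interval_closed.
    by apply: closureS; exact: supp.
  split.
  - move=> m x; apply: smooth_derivable => j.
    apply: CkD; first exact: smooth_zoom.
    have := CkM (Ck_cst j (-1)) (smooth_zoom ss n.+1%:R b 2 j).
    rewrite (_ : (fun x => -1 * _) = (fun x => - s (zoom n.+1%:R b 2 x)))//.
    by apply/funext => y; rewrite mulN1r.
  - apply: (subclosed_compact _ (@segment_compact R _ _) cl);
    exact: closed_closure.
  - apply: subset_trans cl _ => x /=; rewrite !in_itv/= => /andP[xa xb].
    have N0 : 0 < n.+1%:R^-1 :> R by rewrite invr_gt0 ltr0n.
    by move: (n.+1%:R^-1) N0 xa xb => I N0 xa xb; apply/andP; split; lra.
have cphi n : continuous (phi n) := is_derive_continuous (dphiE n).
(* [dphi n] is a difference of two mollifiers, concentrating at [a] from the right and at [b] from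
   the left. *)
have lim1 : Rintegral mu `]-1, 1[ (fun x => f x * dphi n x) @[n --> \oo] -->
  f a - f b.
  have H1 := @mollify R s rho ds crho rho_ge0 rho_out s0 s1 f a (-1) cf.
  have H2 := @mollify R s rho ds crho rho_ge0 rho_out s0 s1 f b 2 cf.
  have cm N c k : continuous (fun x => f x * (N * rho (zoom N c k x))).
    by move=> x; apply: cvgM; [exact: cf|exact: continuous_mollifier].
  have im N c k : mu.-integrable `]-1, 1[
      (EFin \o (fun x => f x * (N * rho (zoom N c k x)))).
    apply: integrableS (continuous_integrable (-1) 1 (cm N c k)) => //.
    exact: subset_itv_oo_cc.
  have -> : (fun n => Rintegral mu `]-1, 1[ (fun x => f x * dphi n x)) =
    (fun n =>
       Rintegral mu `]-1, 1[
         (fun x => f x * (n.+1%:R * rho (zoom n.+1%:R a (-1) x))) -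
       Rintegral mu `]-1, 1[
         (fun x => f x * (n.+1%:R * rho (zoom n.+1%:R b 2 x)))).
    apply/funext => n; rewrite -RintegralB//.
    by apply: eq_Rintegral => x _; rewrite mulrBr.
  have big0 (c : R) : 0 < c -> \forall n \near \oo, 2 <= n.+1%:R * c.
    exact: nearoo_ge_mul.
  apply: cvgB; [apply: H1|apply: H2].
  - near=> n; rewrite /zoom; split.
      have : 0 <= n.+1%:R * (a + 1) by rewrite mulr_ge0// -lerBlDr sub0r.
      lra.
    have : 2 <= n.+1%:R * (1 - a).
      by near: n; apply: big0; rewrite subr_gt0; exact: lt_le_trans ab b1.
    lra.
  - near=> n; rewrite /zoom; split.
      have : 2 <= n.+1%:R * (b + 1).
        by near: n; apply: big0; rewrite -[1]opprK subr_gt0;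
          exact: le_lt_trans a1 ab.
      lra.
    have : 0 <= n.+1%:R * (1 - b) by rewrite mulr_ge0// subr_ge0.
    lra.
have mg : measurable_fun (`]-1, 1[%classic : set R) g.
  by case/integrableP : ig => /measurable_EFinP.
have lim2 : Rintegral mu `]-1, 1[ (fun x => g x * phi n x) @[n --> \oo] -->
    Rintegral mu `]a, b[ g.
  have -> : Rintegral mu `]a, b[ g = Rintegral mu `]-1, 1[ (g \_ `]a, b[).
    rewrite -Rintegral_mkcondr; congr (Rintegral mu _ g).
    rewrite setIidr// => x /=; rewrite !in_itv/= => /andP[? ?].
    by apply/andP; split; lra.
  apply: (@Rintegral_dominated _ _ _ _ (fun x => `|g x|)) => //.
  - move=> n; apply: measurable_funM => //; apply: measurable_funTS.
    exact: continuous_measurable_fun.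
  - apply/measurable_restrict => //; apply: measurable_funS mg => //.
  - move=> x _; apply: eventually_cst_cvg; rewrite patchE.
    have N0 n : 0 < n.+1%:R :> R by rewrite ltr0n.
    case: ifPn; rewrite ?in_setE/= ?notin_setE/= in_itv/= => xab.
      case/andP: xab => ax xb; near=> n; rewrite /phi s1 ?s0 ?subr0 ?mulr1//.
        have : 2 <= n.+1%:R * (b - x) by near: n; apply: nearoo_ge_mul;
          rewrite subr_gt0.
        rewrite /zoom; lra.
      have : 2 <= n.+1%:R * (x - a) by near: n; apply: nearoo_ge_mul;
        rewrite subr_gt0.
      rewrite /zoom; lra.
    near=> n.
    have n3 : 3 <= n.+1%:R * (b - a) by near: n; exact: big3.
    have [->|/eqP p0] := eqVneq (phi n x) 0; first by rewrite mulr0.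
    exfalso; apply: xab; have := supp n n3 x (introN eqP p0).
    rewrite /= in_itv/= => /andP[h1 h2].
    have I0 : 0 < n.+1%:R^-1 :> R by rewrite invr_gt0.
    by move: (n.+1%:R^-1) I0 h1 h2 => I I0 h1 h2; apply/andP; split; lra.
  - have := integrable_norm ig; exact.
  - move=> x n _; rewrite normrM ler_piMr// ler_norml /phi.
    have /andP[? ?] := s01 (zoom n.+1%:R a (-1) x).
    have /andP[? ?] := s01 (zoom n.+1%:R b 2 x).
    by apply/andP; split; lra.
(* Only for large [n] is [phi n] a test function; the two limits of this sequence must then
   agree. *)
have lim3 : Rintegral mu `]-1, 1[ (fun x => f x * dphi n x) @[n --> \oo] -->
    - Rintegral mu `]a, b[ g.
  apply: cvg_trans (cvgN lim2); apply: near_eq_cvg; near=> n.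
  have n3 : 3 <= n.+1%:R * (b - a) by near: n; exact: big3.
  rewrite [in RHS](_ : (fun x => _) = (fun x => f x * derive1 (phi n) x)).
    exact/esym/wfg/test.
  by rewrite (derive1_ext (dphiE n)).
have := cvg_unique _ lim1 lim3 => /(_ (@Rhausdorff R)) E.
by rewrite -[LHS]opprK -E opprB.
Unshelve. all: by end_near. Qed.

End WeakDerivative.

(** * The chain rule for primitives of integrable functions *)

Section ChainRule.
Context {R : realType}.
Implicit Types f g K : R -> R.
Notation mu := (@lebesgue_measure R).

Lemma integrable_itvS f (a b c d : R) : a <= c -> d <= b ->
  mu.-integrable `]a, b[ (EFin \o f) -> mu.-integrable `]c, d[ (EFin \o f).
Proof.
move=> ac db; apply: integrableS => // x; rewrite /= !in_itv/= => /andP[cx xd].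
by rewrite (le_lt_trans ac cx) (lt_le_trans xd db).
Qed.

Lemma integrable_continuousM K g (a b : R) : continuous K ->
  mu.-integrable `]a, b[ (EFin \o g) ->
  mu.-integrable `]a, b[ (EFin \o (fun x => K x * g x)).
Proof.
move=> cK ig; have := @integrableMr _ _ R mu _ (measurable_itv `]a, b[) K
  (EFin \o g).
apply => //; first by apply: measurable_funTS; exact: continuous_measurable_fun.
have [ab|ba] := leP a b; last first.
  by rewrite set_itv_ge ?bnd_simp -?leNgt 1?ltW//; exists 0; split => // M _ x.
have [|c _ hc] := @EVT_max R (fun x => `|K x|) a b ab.
  by apply: continuous_subspaceT => x; apply: cvg_norm; exact: cK.
exists `|K c|; split; first exact: num_real.
move=> M cM x /=; rewrite in_itv/= => /andP[ax xb]; apply: le_trans (ltW cM).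
by apply: hc; rewrite in_itv/= !ltW.
Qed.

Lemma Rintegral_itvoo_split f (a b c : R) : a < b -> b < c ->
  mu.-integrable `]a, c[ (EFin \o f) ->
  Rintegral mu `]a, c[ f = Rintegral mu `]a, b[ f + Rintegral mu `]b, c[ f.
Proof.
move=> ab bc fi; rewrite (@Rintegral_itv_bndo_bndc _ (BRight a) b); last first.
  exact: integrable_itvS (lexx a) (ltW bc) fi.
by rewrite -(@Rintegral_itvB _ f (BRight a) (BLeft c) b fi)
  ?bnd_simp ?(ltW ab)// addrC subrK.
Qed.

Lemma uniform_continuity_itv f (a b e : R) : continuous f -> 0 < e ->
  exists2 d : R, 0 < d & forall x y : R, a <= x <= b -> `|x - y| < d ->
    `|f x - f y| <= e.
Proof.
move=> cf e0.
have /compact_near_coveringP cov := @segment_compact R a b.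
have e2 : 0 < e / 2 by rewrite divr_gt0.
(* In its near-covering form, compactness turns a property holding near each point for all small
   [d > 0] into one holding on all of [a, b] for a common [d]. *)
have [|d /= d0 hd] := cov R (0^'+) (fun d x => forall y, `|x - y| < d ->
  `|f x - f y| <= e) _.
  move=> x _; have /cvgrPdist_le/(_ _ e2)[r /= r0 hr] := cf x.
  have r2 : 0 < r / 2 by rewrite divr_gt0.
  near=> z d => y zy.
  have xz : `|x - z| < r / 2 by near: z; exact: nbhsx_ballx.
  have dr : d <= r / 2 by near: d; exact: nbhs_right_le.
  have h1 : `|f x - f z| <= e / 2 by apply: hr => /=; lra.
  have h2 : `|f x - f y| <= e / 2.
    apply: hr => /=; apply: le_lt_trans (ler_distD z x y) _.
    by rewrite [r in _ < r]splitr ltrD// (lt_le_trans zy dr).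
  apply: le_trans (ler_distD (f x) _ _) _.
  by rewrite [e]splitr lerD// distrC.
exists (d / 2); first by rewrite divr_gt0.
move=> x y xab; apply: (hd (d / 2)) => //=; rewrite ?in_itv ?divr_gt0//=.
by rewrite sub0r normrN gtr0_norm ?divr_gt0//; lra.
Unshelve. all: by end_near. Qed.

(** The mean value theorem for [H] gives a point between [f x] and [f y], which the intermediate
    value theorem pulls back to some [z] in [x, y]; [f] need only be continuous. *)
Lemma mean_value_comp f (H K : R -> R) (x y : R) : continuous f ->
  (forall z : R, is_derive z 1 H (K z)) -> x < y ->
  exists2 z, x <= z <= y & H (f y) - H (f x) = K (f z) * (f y - f x).
Proof.
move=> cf dH xy.
have ivt v : Num.min (f x) (f y) <= v <= Num.max (f x) (f y) ->
    exists2 z, x <= z <= y & f z = v.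
  move=> hv; have [|z] := IVT (ltW xy) _ hv; first exact: continuous_subspaceT.
  by rewrite in_itv/=; exists z.
have [fxy|fyx|<-] := ltgtP (f x) (f y).
- have [c /andP[c1 c2] ->] := mean_value dH fxy.
  have [|z xzy <-] := ivt c; last by exists z.
  by rewrite min_l ?max_r ?ltW.
- have [c /andP[c1 c2] h] := mean_value dH fyx.
  have [|z xzy zc] := ivt c; first by rewrite min_r ?max_l ?ltW.
  by exists z => //; rewrite zc -[LHS]opprB h -mulrN opprB.
- by exists x; rewrite ?lexx ?(ltW xy)// !subrr mulr0.
Qed.

(* Summed over a fine partition, the mean value theorem
   [H (f y) - H (f x) = K (f z) (f y - f x)] and the uniform continuity of
   [K o f] bound the error by [e] times the integral of [|g|]. *)
Lemma FTC_chain_rule f g (H K : R -> R) (A B : R) : continuous f ->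
  continuous K ->
  (forall z : R, is_derive z 1 H (K z)) -> mu.-integrable `]A, B[ (EFin \o g) ->
  (forall x y, A <= x -> x < y -> y <= B ->
    Rintegral mu `]x, y[ g = f y - f x) ->
  A < B -> Rintegral mu `]A, B[ (fun x => K (f x) * g x) = H (f B) - H (f A).
Proof.
move=> cf cK dH ig fg AB.
have cKf : continuous (fun x => K (f x)).
  by move=> x; apply: (continuous_comp (cf x)); exact: cK.
have iKg : mu.-integrable `]A, B[ (EFin \o (fun x => K (f x) * g x)).
  exact: (@integrable_continuousM (fun x => K (f x))).
have ing : mu.-integrable `]A, B[ (EFin \o (fun x => `|g x|)).
  exact: integrable_norm ig.
pose err x y := H (f y) - H (f x) -
  Rintegral mu `]x, y[ (fun x => K (f x) * g x).
pose m x y := Rintegral mu `]x, y[ (fun x => `|g x|).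
suff main e : 0 < e -> `|err A B| <= e * m A B.
  apply/esym/eqP; rewrite -subr_eq0 -normr_le0 -/(err A B).
  have m0 : 0 <= m A B by apply: Rintegral_ge0 => x _.
  (* The [+ 1] keeps the divisor positive when [m A B] is 0. *)
  apply/ler_addgt0Pr => e e0; rewrite add0r -[e](@divfK _ (m A B + 1))
    ?gt_eqF ?ltr_wpDl//.
  apply: le_trans (main (e / (m A B + 1)) _) _; first
    by rewrite divr_gt0 ?ltr_wpDl.
  by rewrite ler_pM2l ?divr_gt0 ?ltr_wpDl// lerDl.
move=> e0.
have [d d0 hd] := uniform_continuity_itv A B cKf e0.
have loc x y : A <= x -> x < y -> y <= B -> y - x < d ->
  `|err x y| <= e * m x y.
  move=> Ax xy yB yxd; rewrite /err.
  have [z /andP[xz zy] ->] := mean_value_comp cf dH xy.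
  have igxy := integrable_itvS Ax yB ig.
  have iKxy := integrable_itvS Ax yB iKg.
  rewrite -fg// -RintegralZl// -RintegralB//; last first.
    exact: (@integrable_continuousM (cst (K (f z))) g _ _ (fun=> cvg_cst _)).
  have ih : mu.-integrable `]x, y[
      (EFin \o (fun t => (K (f z) - K (f t)) * g t)).
    apply: (@integrable_continuousM (fun t => K (f z) - K (f t))) => // t.
    by apply: cvgB; [exact: cvg_cst|exact: cKf].
  under eq_Rintegral do rewrite -mulrBl.
  apply: le_trans (le_normr_Rintegral _ _) _ => //.
  have inxy := integrable_itvS Ax yB ing.
  rewrite /m -RintegralZl//; apply: le_Rintegral => //.
  - exact: integrable_norm ih.
  - exact: (@integrable_continuousM (cst e) (fun t => `|g t|) _ _
    (fun=> cvg_cst _)).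
  move=> t; rewrite /= in_itv/= => /andP[xt ty]; rewrite normrM ler_wpM2r//.
  apply: hd; first by rewrite (le_trans Ax xz) (le_trans zy yB).
  by rewrite ltr_norml; apply/andP; split; lra.
have [n nd] : exists n, B - A < n.+1%:R * d.
  exists (Num.trunc ((B - A) / d)); rewrite -ltr_pdivrMr//.
  exact: truncnS_gt.
pose N : R := n.+1%:R; have N0 : 0 < N by rewrite ltr0n.
pose h := (B - A) / N; have h0 : 0 < h by rewrite divr_gt0// subr_gt0.
have hd' : h < d by rewrite ltr_pdivrMr// mulrC.
have hN : N * h = B - A by rewrite mulrC divfK// gt_eqF.
(* Both [err] and [m] are additive over adjacent intervals. The induction starts with one whole
   cell, because the splitting lemma requires nonempty pieces. *)
have step i : (i.+1 <= n.+1)%N ->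
    `|err A (A + i.+1%:R * h)| <= e * m A (A + i.+1%:R * h).
  elim: i => [_|i IH iN].
    apply: loc; rewrite ?mul1r ?ltrDl//.
      by have : h <= N * h; [rewrite ler_peMl ?(ltW h0)// /N ler1n|lra].
    by rewrite addrC addKr.
  set p := A + i.+1%:R * h; set q := A + i.+2%:R * h.
  have pq : q - p = h by rewrite /q /p -[i.+2%:R]natr1; ring.
  have Ap : A < p by rewrite ltrDl mulr_gt0// ltr0n.
  have qB : q <= B.
    have : i.+2%:R * h <= N * h by rewrite ler_pM2r// ler_nat.
    rewrite /q; lra.
  have pq' : p < q by lra.
  have -> : err A q = err A p + err p q.
    rewrite /err (@Rintegral_itvoo_split _ A p q)//; first by ring.
    exact: integrable_itvS (lexx A) qB iKg.
  have -> : m A q = m A p + m p q.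
    by rewrite /m (@Rintegral_itvoo_split _ A p q)//;
      exact: integrable_itvS (lexx A) qB ing.
  apply: le_trans (ler_normD _ _) _; rewrite mulrDr lerD//.
    by apply: IH; exact: ltnW.
  by apply: loc; lra.
have := step n (leqnn _); rewrite -/N hN.
by have -> : A + (B - A) = B by ring.
Qed.

End ChainRule.

(** * The Willmore energy *)

Section Kernel.
Context {R : realType}.
Implicit Types f g K : R -> R.
Notation mu := (@lebesgue_measure R).

Lemma add1sqr_gt0 (t : R) : 0 < 1 + t ^+ 2.
Proof. by rewrite ltr_pwDl ?sqr_ge0. Qed.

Lemma continuous_add1sqr : continuous (fun t : R => 1 + t ^+ 2).
Proof.
move=> x; apply: cvgD; first exact: cvg_cst.
exact: exprn_continuous.
Qed.

(** The exponent [a = 5 / 4] gives the derivative of [G]; [a = 3 / 2] gives the kernel of the mixed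
    term. *)
Definition slope_kernel (a t : R) : R := 1 / (1 + t ^+ 2) `^ a.

Lemma continuous_slope_kernel a : continuous (slope_kernel a).
Proof.
move=> x; apply: cvgM; first exact: cvg_cst.
have r0 := add1sqr_gt0 x.
apply: cvgV; first by rewrite gt_eqF// powR_gt0.
apply: (@continuous_comp _ _ _ (fun t : R => 1 + t ^+ 2) (fun y => y `^ a)).
  exact: continuous_add1sqr.
exact/differentiable_continuous/derivable1_diffP/ex_derive/is_derive1_powR.
Qed.

Lemma G_primitive (t : R) : G t = primitive (slope_kernel (5 / 4)) t.
Proof. by []. Qed.

(** The sum of the two sides, [primitive K y + primitive K (- y)], has zero derivative and vanishes
    at 0. *)
Lemma primitive_odd K : continuous K -> (forall x, K (- x) = K x) ->
  forall x, primitive K (- x) = - primitive K x.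
Proof.
move=> cK eK x; have dP := is_derive_primitive cK.
have h (y : R) : is_derive y 1 (fun y => primitive K y + primitive K (- y)) 0.
  have h1 := is_derive1_comp (dP (- y)) (is_deriveN (is_derive_id y (1 : R))).
  by have := is_deriveD (dP y) h1; rewrite eK mulrN1 subrr.
have := derive0_const h x 0; rewrite oppr0.
have -> : primitive K 0 = 0 by rewrite /primitive lexx set_itv1 Rintegral_set1.
by rewrite addr0 => /eqP; rewrite addrC addr_eq0 => /eqP.
Qed.

Lemma G_odd (t : R) : G (- t) = - G t.
Proof.
rewrite !G_primitive; apply: primitive_odd;
  first exact: continuous_slope_kernel.
by move=> x; rewrite /slope_kernel sqrrN.
Qed.

Lemma powR32 (r : R) : 0 < r -> r `^ (3 / 2) = Num.sqrt r ^+ 3.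
Proof.
move=> r0; rewrite mulrC powRrM powR12_sqrt ?ltW//.
by rewrite powR_mulrn// sqrtr_ge0.
Qed.

Lemma powR54_sqr (r : R) : 0 < r -> (r `^ (5 / 4)) ^+ 2 = Num.sqrt r ^+ 5.
Proof.
move=> r0; rewrite -powR_mulrn ?powR_ge0// -powRrM.
have -> : 5 / 4 * 2%:R = 2^-1 * 5%:R :> R by field.
by rewrite powRrM powR12_sqrt ?ltW// powR_mulrn// sqrtr_ge0.
Qed.

(* With p = v' and w = v'', the second summand is v ((G o v')')^2 and the last
   one an exact derivative. *)
Lemma willmore_integrandE (v p w : R) : 0 < v ->
  (1 / (v * Num.sqrt (1 + p ^+ 2)) - w / (1 + p ^+ 2) `^ (3 / 2)) ^+ 2 * v
    * Num.sqrt (1 + p ^+ 2) =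
  (v * Num.sqrt (1 + p ^+ 2))^-1 + v * slope_kernel (5 / 4) p ^+ 2 * w ^+ 2 -
    2 * (slope_kernel (3 / 2) p * w).
Proof.
move=> v0; have r0 := add1sqr_gt0 p.
(* In terms of [q = sqrt (1 + p^2)] only integer powers remain, and the identity is rational in [v],
   [w] and [q]. *)
rewrite /slope_kernel powR32// expr_div_n powR54_sqr// expr1n.
have := r0; rewrite -sqrtr_gt0; move: (Num.sqrt _) => q q0.
by field; rewrite !gt_eqF.
Qed.

End Kernel.

(** * The lower bound for continuous extensions of [u] and [u'] *)

Section Energy.
Context {R : realType}.
Notation mu := (@lebesgue_measure R).

(** [p] is tied to [u] only through integrals, so its primitive [P] is differentiated instead: near
    [x], [P y - P (- y)] equals [u y - u (- y) = 0], while its derivative at [x] is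
    [p x + p (- x)]. *)
Lemma even_FTC_odd (u p : R -> R) (a x : R) : continuous p ->
  (forall x y : R, - a <= x -> x < y -> y <= a ->
    Rintegral mu `]x, y[ p = u y - u x) ->
  (forall x : R, - a <= x <= a -> u (- x) = u x) -> - a < x < a ->
    p (- x) = - p x.
Proof.
move=> cp up ue xa.
have dP := is_derive_primitive cp.
have cP := is_derive_continuous dP.
have uP (z y : R) : - a <= z <= a -> - a <= y <= a ->
  primitive p y - primitive p z = u y - u z.
  wlog zy : z y / z < y => [H|].
    have [/H//|yz|->] := ltgtP z y; last by rewrite !subrr.
    by move=> hz hy; rewrite -opprB H// opprB.
  move=> /andP[az _] /andP[_ ya]; rewrite -(up _ _ az zy ya).
  by rewrite Rintegral_itvoo_cc;
    [rewrite (FTC2_everywhere dP)|exact: continuous_integrable].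
have D1 : is_derive x 1 (fun y => primitive p y - primitive p (- y))
    (p x + p (- x)).
  have h1 := is_derive1_comp (dP (- x)) (is_deriveN (is_derive_id x (1 : R))).
  by have := is_deriveB (dP x) h1; rewrite mulrN1 opprK.
have D2 : is_derive x 1 (fun y => primitive p y - primitive p (- y)) 0.
  apply: (@near_eq_is_derive _ _ _ (cst 0)) => //.
  have /andP[ax xa'] := xa.
  near=> y.
  have ay : - a <= y by apply/ltW; near: y; exact: lt_nbhsr.
  have ya : y <= a by apply/ltW; near: y; exact: lt_nbhsl.
  have ya2 : - a <= y <= a by rewrite ay.
  by rewrite uP// ?ue ?subrr//; apply/andP; split; lra.
have [_ E1] := D1; have [_ E2] := D2.
by apply/eqP; rewrite -addr_eq0 addrC -E1 E2.
Unshelve. all: by end_near. Qed.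

(* Instead of the Cauchy-Schwarz inequality, [h^2 >= 2 l h - l^2] is used with
   [l] the integral of [h]. *)
Lemma Rintegral_sq_lower (E h : R -> R) (x y m c : R) : x < y -> 0 <= c ->
  mu.-integrable `]x, y[ (EFin \o E) -> mu.-integrable `]x, y[ (EFin \o h) ->
  (forall t, x < t < y -> m + c * h t ^+ 2 <= E t) ->
  m * (y - x) + c * (2 - (y - x)) * Rintegral mu `]x, y[ h ^+ 2 <=
  Rintegral mu `]x, y[ E.
Proof.
move=> xy c0 iE ih hE; set l := Rintegral mu `]x, y[ h.
pose L t := (m - c * l ^+ 2) + (2 * c * l) * h t.
have fmu : fine (mu `]x, y[%classic) = y - x.
  by rewrite lebesgue_measure_itv/= lte_fin xy.
have icst (r : R) : mu.-integrable `]x, y[ (EFin \o (fun=> r)).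
  apply: integrableS (@continuous_integrable _ (fun=> r) x y
    (fun=> cvg_cst _)) => //.
  exact: subset_itv_oo_cc.
have ilh : mu.-integrable `]x, y[ (EFin \o (fun t => (2 * c * l) * h t)).
  exact: (@integrable_continuousM _ (fun=> 2 * c * l) h _ _ (fun=> cvg_cst _)).
have iL : mu.-integrable `]x, y[ (EFin \o L).
  have := @integrableD _ _ R mu _ (measurable_itv `]x, y[) _ _
    (icst (m - c * l ^+ 2)) ilh.
  exact.
have -> : m * (y - x) + c * (2 - (y - x)) * l ^+ 2 = Rintegral mu `]x, y[ L.
  by rewrite RintegralD// Rintegral_cst// fmu RintegralZl// -/l; ring.
apply: le_Rintegral => // t; rewrite /= in_itv/= => txy.
apply: le_trans (hE t txy); rewrite /L -addrA lerD2l.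
have : 0 <= c * (h t - l) ^+ 2 by rewrite mulr_ge0 ?sqr_ge0.
by rewrite !expr2; lra.
Qed.

(** The point is the maximum of the compact set of [t] in [x, 1] with [S <= |p t|]. A strict
    inequality there would give, as [p 1 = 0], a later point with [|p| = S]. *)
Lemma last_large (p : R -> R) (S x : R) : continuous p ->
  x \in `[-1, 1] -> S <= `|p x| -> p 1 = 0 -> 0 < S ->
  exists2 x1, x <= x1 < 1 & `|p x1| = S /\ forall t, x1 < t <= 1 -> `|p t| < S.
Proof.
move=> cp; rewrite in_itv/= => /andP[x1 x2] Sx p1 S0.
have cn : continuous (fun t => `|p t|) by move=> t; apply: cvg_norm; exact: cp.
pose T := `[x, 1]%classic `&` [set t | S <= `|p t|].
have Tx : T x by split => //; rewrite /= in_itv/= lexx.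
have cT : compact T.
  apply: compact_closedI; first exact: segment_compact.
  by apply: (preimage_closed _ (@closed_ge R S)) => t _; exact: cn.
have T0 : T !=set0 by exists x.
have [|x0 x0T hx0] := @compact_EVT_max R R id T T0 cT.
  by apply: continuous_subspaceT => t; exact: cvg_id.
move: x0T; rewrite inE => -[/=]; rewrite in_itv/= => /andP[xx0 x01] Sx0.
have lt1 : x0 < 1.
  rewrite lt_neqAle x01 andbT; apply: contraTneq Sx0 => ->.
  by rewrite p1 normr0 -ltNge.
have hlt t : x0 < t <= 1 -> `|p t| < S.
  move=> /andP[x0t t1]; rewrite ltNge; apply/negP => St.
  have Tt : T t by split => //=; rewrite in_itv/= (le_trans xx0 (ltW x0t)).
  by have := hx0 t (mem_set Tt); rewrite /= leNgt x0t.
exists x0; first by rewrite xx0.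
split => //; apply/eqP; rewrite eq_le Sx0 andbT leNgt; apply/negP => Slt.
have [|y] := @IVT R (fun t => `|p t|) x0 1 S x01 (continuous_subspaceT cn).
  by rewrite p1 normr0 min_r// max_l// (ltW S0) (ltW Slt).
rewrite in_itv/= => /andP[x0y y1] yS.
have [x0y'|] := ltP x0 y.
  by have := hlt y; rewrite x0y' y1 yS ltxx => /(_ isT).
move=> yx0; have yE : y = x0 by apply/le_anti; rewrite yx0.
by move: Slt; rewrite -yE yS ltxx.
Qed.

Lemma willmore_estimate (u p g : R -> R) (alpha S x : R) :
  continuous u -> continuous p -> (forall t, 0 < u t) ->
  mu.-integrable `]-1, 1[ (EFin \o g) ->
  mu.-integrable `]-1, 1[ (EFin \o (fun t => g t ^+ 2)) ->
  (forall x y : R, -1 <= x -> x < y -> y <= 1 ->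
    Rintegral mu `]x, y[ p = u y - u x) ->
  (forall x y : R, -1 <= x -> x < y -> y <= 1 ->
    Rintegral mu `]x, y[ g = p y - p x) ->
  (forall x : R, -1 <= x <= 1 -> u (- x) = u x) ->
  u 1 = alpha -> p 1 = 0 -> p (-1) = 0 ->
  0 < S -> S < alpha -> x \in `[-1, 1] -> S <= `|p x| ->
  let F t := (u t * Num.sqrt (1 + p t ^+ 2))^-1 +
    u t * slope_kernel (5 / 4) (p t) ^+ 2 * g t ^+ 2 -
    2 * (slope_kernel (3 / 2) (p t) * g t) in
  mu.-integrable `]-1, 1[ (EFin \o F) /\
  2 * (alpha - S) * G S ^+ 2 < Rintegral mu `]-1, 1[ F.
Proof.
move=> cu cp u0 ig ig2 up pg ue u1 p1 pN1 S0 Sa xI Sx F.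
have podd (t : R) : -1 <= t <= 1 -> p (- t) = - p t.
  move=> /andP[]; rewrite le_eqVlt => /predU1P[<- _|t1].
    by rewrite opprK p1 pN1 oppr0.
  rewrite le_eqVlt => /predU1P[->|t2]; first by rewrite p1 pN1 oppr0.
  by apply: (@even_FTC_odd u p 1); rewrite ?t1.
have [x1 /andP[xx1 x11] [px1 hx1]] : exists2 x1, 0 < x1 < 1 &
    `|p x1| = S /\ forall t, x1 < t <= 1 -> `|p t| < S.
  have [y0 y01 Sy0] : exists2 y, 0 <= y <= 1 & S <= `|p y|.
    move: (xI); rewrite in_itv/= => /andP[xl xr].
    have [x0|x0] := leP 0 x; first by exists x => //; rewrite x0.
    exists (- x); first by rewrite oppr_ge0 (ltW x0) lerNl.
    by rewrite podd ?normrN// xl.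
  have y0I : y0 \in `[-1, 1].
    by move: y01; rewrite in_itv/= => /andP[h ->]; rewrite andbT; lra.
  have [x1 /andP[h1 h2] [h3 h4]] := last_large cp y0I Sy0 p1 S0.
  exists x1 => //; rewrite h2 andbT lt_neqAle; apply/andP; split; last first.
    by case/andP: y01 => h _; exact: le_trans h1.
  (* Oddness forces [p 0 = 0], which excludes [x1 = 0] since [|p x1| = S > 0]. *)
  apply/eqP => x10; have := podd 0; rewrite oppr0 => /(_ _)/eqP.
  rewrite -subr_eq0 opprK -mulr2n mulrn_eq0/= => h.
  have /eqP p00 : p 0 == 0 by apply: h; rewrite lerN10 ler01.
  move: h3; rewrite -x10 p00.
  by rewrite normr0 => S00; move: S0; rewrite -S00 ltxx.
have [x1N1 N1x1 Nx1x1 Nx11] : [/\ -1 <= x1, -1 < - x1, - x1 < x1 & - x1 <= 1].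
  by split; lra.
have x1W := ltW x11; have N1x1W := ltW N1x1.
have dU := is_derive_primitive cp.
have ulow (t : R) : x1 < t < 1 -> alpha - S <= u t.
  move=> /andP[x1t t1].
  have t1' : -1 <= t by lra.
  have h := up t 1 t1' t1 (lexx 1).
  move: h; rewrite Rintegral_itvoo_cc; last exact: continuous_integrable.
  rewrite (FTC2_everywhere dU)//.
  have [c /andP[tc c1] ->] := mean_value dU t1.
  have : `|p c| < S by apply: hx1; rewrite (lt_trans x1t tc) ltW.
  rewrite ltr_norml => /andP[pc1 pc2].
  have : p c * (1 - t) <= S * (1 - t) by rewrite ler_wpM2r// ?subr_ge0 ltW.
  have : S * (1 - t) <= S by rewrite ler_piMr// ltW//; lra.
  rewrite u1; lra.
have ulowN (t : R) : -1 < t < - x1 -> alpha - S <= u t.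
  move=> /andP[t1 t2]; rewrite -[u t]ue; last by apply/andP; split; lra.
  by apply: ulow; apply/andP; split; lra.
have cQ : continuous (fun t => u t * Num.sqrt (1 + p t ^+ 2)).
  move=> t; apply: cvgM; first exact: cu.
  apply: (@continuous_comp _ _ _ (fun t : R => 1 + p t ^+ 2) Num.sqrt);
    last exact: sqrt_continuous.
  apply: (@continuous_comp _ _ _ p (fun t : R => 1 + t ^+ 2)); first exact: cp.
  exact: continuous_add1sqr.
have Q0 t : 0 < u t * Num.sqrt (1 + p t ^+ 2).
  by rewrite mulr_gt0// sqrtr_gt0 add1sqr_gt0.
have cA : continuous (fun t => (u t * Num.sqrt (1 + p t ^+ 2))^-1).
  by move=> t; apply: cvgV; [rewrite gt_eqF|exact: cQ].
(* This uniform bound on the first term is the source of the strict inequality. *)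
have [m m0 hm] : exists2 m, 0 < m &
    forall t : R, -1 <= t <= 1 -> m <= (u t * Num.sqrt (1 + p t ^+ 2))^-1.
  have [|c _ hc] := @EVT_min R _ (-1) 1 _ (continuous_subspaceT cA); first
    by lra.
  by exists ((u c * Num.sqrt (1 + p c ^+ 2))^-1); rewrite ?invr_gt0// => t;
    have := hc t; rewrite in_itv.
have ck a : continuous (fun t => slope_kernel a (p t)).
  by move=> t; apply: (@continuous_comp _ _ _ p (slope_kernel a));
    [exact: cp|exact: continuous_slope_kernel].
pose h t := slope_kernel (5 / 4) (p t) * g t.
have ih : mu.-integrable `]-1, 1[ (EFin \o h).
  exact: (integrable_continuousM (ck _) ig).
have ih3 : mu.-integrable `]-1, 1[
    (EFin \o (fun t => slope_kernel (3 / 2) (p t) * g t)).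
  exact: (integrable_continuousM (ck _) ig).
pose E t := (u t * Num.sqrt (1 + p t ^+ 2))^-1 +
  u t * slope_kernel (5 / 4) (p t) ^+ 2 * g t ^+ 2.
have iA : mu.-integrable `]-1, 1[
    (EFin \o (fun t => (u t * Num.sqrt (1 + p t ^+ 2))^-1)).
  apply: integrableS (continuous_integrable (-1) 1 cA) => //.
  exact: subset_itv_oo_cc.
have iB : mu.-integrable `]-1, 1[
    (EFin \o (fun t => u t * slope_kernel (5 / 4) (p t) ^+ 2 * g t ^+ 2)).
  apply: (@integrable_continuousM _ (fun t =>
    u t * slope_kernel (5 / 4) (p t) ^+ 2)) => // t.
  apply: cvgM; first exact: cu.
  by apply: cvgM; exact: ck.
have iE : mu.-integrable `]-1, 1[ (EFin \o E).
  have := @integrableD _ _ R mu _ (measurable_itv `]-1, 1[) _ _ iA iB; exact.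
have i2 : mu.-integrable `]-1, 1[
    (EFin \o (fun t => 2 * (slope_kernel (3 / 2) (p t) * g t))).
  exact: (@integrable_continuousM _ (fun=> 2) _ _ _ (fun=> cvg_cst _)).
have iF : mu.-integrable `]-1, 1[ (EFin \o F).
  have := @integrableB _ _ R mu _ (measurable_itv `]-1, 1[) _ _ iE i2; exact.
split => //.
have chain (a x2 y : R) : -1 <= x2 -> x2 < y -> y <= 1 ->
    Rintegral mu `]x2, y[ (fun t => slope_kernel a (p t) * g t) =
    primitive (slope_kernel a) (p y) - primitive (slope_kernel a) (p x2).
  move=> h1 h2 h3.
  apply: (FTC_chain_rule cp (@continuous_slope_kernel R a)) => //.
  - exact/is_derive_primitive/continuous_slope_kernel.
  - exact: integrable_itvS ig.
  - move=> s t hs st ht.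
    by apply: pg => //; [exact: le_trans hs|exact: le_trans h3].
have -> : Rintegral mu `]-1, 1[ F = Rintegral mu `]-1, 1[ E.
  rewrite [LHS]RintegralB// RintegralZl// chain//.
  by rewrite p1 pN1 subrr mulr0 subr0.
have c0 : 0 <= alpha - S by rewrite subr_ge0 ltW.
have low (c x2 y : R) : 0 <= c -> -1 <= x2 -> x2 < y -> y <= 1 ->
    (forall t, x2 < t < y -> c <= u t) ->
    m * (y - x2) + c * (2 - (y - x2)) * Rintegral mu `]x2, y[ h ^+ 2 <=
    Rintegral mu `]x2, y[ E.
  move=> hc h1 h2 h3 hu; apply: Rintegral_sq_lower => //.
  - exact: integrable_itvS iE.
  - exact: integrable_itvS ih.
  move=> t ty; rewrite /E lerD//.
    case/andP: ty => h4 h5; apply: hm.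
    by rewrite (le_trans h1 (ltW h4)) (le_trans (ltW h5) h3).
  by rewrite /h exprMn mulrA ler_wpM2r ?sqr_ge0// ler_wpM2r ?sqr_ge0// hu.
have G0 : G 0 = 0 :> R.
  by rewrite G_primitive /primitive lexx set_itv1 Rintegral_set1.
have GS (y : R) : `|y| = S -> G y ^+ 2 = G S ^+ 2.
  by move=> <-; have [y0|y0] := leP 0 y;
    [rewrite ger0_norm|rewrite ltr0_norm// G_odd sqrrN].
have low1 := low (alpha - S) (-1) (- x1) c0 (lexx _).
(* In the middle, [c = 0] discards the curvature term: only nonnegativity is wanted there. *)
have low2 := low 0 (- x1) x1 (lexx _).
have low3 := low (alpha - S) x1 1 c0.
have e1 : Rintegral mu `]-1, -x1[ h ^+ 2 = G S ^+ 2.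
  by rewrite chain// -!G_primitive pN1 G0 subr0 GS// podd ?normrN// x1N1.
have e3 : Rintegral mu `]x1, 1[ h ^+ 2 = G S ^+ 2.
  by rewrite chain// -!G_primitive p1 G0 sub0r sqrrN GS.
rewrite (Rintegral_itvoo_split N1x1 (lt_trans Nx1x1 x11) iE).
rewrite (Rintegral_itvoo_split Nx1x1 x11 (integrable_itvS N1x1W (lexx 1) iE)).
(* The outer intervals have length [1 - x1], so the factor [2 - (y - x)] becomes [1 + x1], which
   exceeds 1. *)
have l1 : m * (- x1 + 1) + (alpha - S) * (1 + x1) * G S ^+ 2 <=
    Rintegral mu `]-1, -x1[ E.
  have := low1; rewrite e1; have -> : 2 - (- x1 - -1) = 1 + x1 by ring.
  by rewrite opprK; apply.
have l2 : 0 <= Rintegral mu `]-x1, x1[ E.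
  have u0W t : - x1 < t < x1 -> 0 <= u t by move=> _; exact: ltW.
  apply: le_trans (low2 N1x1W Nx1x1 x1W u0W).
  by rewrite !mul0r addr0 mulr_ge0 ?(ltW m0)// subr_ge0 ltW.
have l3 : m * (1 - x1) + (alpha - S) * (1 + x1) * G S ^+ 2 <=
    Rintegral mu `]x1, 1[ E.
  have := low3; rewrite e3; have -> : 2 - (1 - x1) = 1 + x1 by ring.
  by apply.
have m1 : 0 < m * (1 - x1) by rewrite mulr_gt0// subr_gt0.
have : 0 <= (alpha - S) * x1 * G S ^+ 2
  by rewrite mulr_ge0 ?sqr_ge0// mulr_ge0// ltW.
move: (Rintegral mu `]-1, -x1[ E)
  (Rintegral mu `]-x1, x1[ E) l1 l2 => I1 I2 l1 l2.
move: (Rintegral mu `]x1, 1[ E) (G S ^+ 2) l1 l3 => I3 g2 l1 l3.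
have m2 : 0 < m * (- x1 + 1) by rewrite addrC.
clear -l1 l2 l3 m1 m2; lra.
Qed.

End Energy.

(** * Transfer to elements of [H2] *)

Section H2.
Context {R : realType}.
Notation mu := (@lebesgue_measure R).

(** The interval has finite measure and [|y| <= 1 + y^2]. *)
Lemma L2_integrable (f : R -> R) :
  L2_function f -> mu.-integrable `]-1, 1[ (EFin \o f).
Proof.
move=> [mf f2].
have i1 : mu.-integrable `]-1, 1[ (EFin \o (fun=> (1 : R))).
  apply: integrableS (@continuous_integrable _ (fun=> 1) (-1) 1
    (fun=> cvg_cst _)) => //.
  exact: subset_itv_oo_cc.
have i2 := @integrableD _ _ R mu _ (measurable_itv `]-1, 1[) _ _ i1 f2.
apply: le_integrable i2 => //; first exact/measurable_EFinP.
move=> x _ /=; rewrite lee_fin [leRHS]ger0_norm ?addr_ge0 ?sqr_ge0//.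
rewrite -(real_normK (num_real (f x))); move: `|f x| (normr_ge0 (f x)) => y y0.
have : 0 <= (y - 1) ^+ 2 by exact: sqr_ge0.
rewrite !expr2; lra.
Qed.

Lemma weak_derivative_FTC (f h g : R -> R) : continuous h ->
  (forall x : R, x \in `[-1, 1] -> h x = f x) ->
  L2_function g -> weak_derivative f g ->
  forall x y : R, -1 <= x -> x < y -> y <= 1 ->
    Rintegral mu `]x, y[ g = h y - h x.
Proof.
move=> ch hf g2 wfg x y; apply: weak_derivative_FTC_continuous => //.
  exact: L2_integrable.
move=> phi /wfg <-; apply: eq_Rintegral => t; rewrite inE/= => tI.
by rewrite hf//; exact: subset_itv_oo_cc tI.
Qed.

Lemma willmore_lower_bound (alpha S : R) (u : H2 R) :
  N alpha u -> 0 < S -> S < alpha ->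
  S <= max_abs_d1 u -> ((pi * (alpha - S) * G S ^+ 2)%:E < W u)%E.
Proof.
move=> [upos [ur ul] [dr dl] ue] S0 Sa Smax.
have a0 : 0 < alpha by exact: lt_trans Sa.
(* [N] gives positivity on the open interval only; at the endpoints it comes from [alpha > 0]. *)
have upos' x : x \in `[-1, 1] -> 0 < u x.
  rewrite in_itv/= => /andP[]; rewrite le_eqVlt => /predU1P[<- _|x1]; first
    by rewrite ul.
  rewrite le_eqVlt => /predU1P[->|x2]; first by rewrite ur.
  by apply: upos; rewrite in_itv/= x1.
have N11 : (-1 : R) <= 1 by lra.
have I1 : (1 : R) \in `[-1, 1] by rewrite in_itv/= lexx N11.
have IN1 : (-1 : R) \in `[-1, 1] by rewrite in_itv/= lexx N11.
have [h [ch hu hpos]] := continuous_extension N11 (@H2_fun_cont R u).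
have [p [cp pd _]] := continuous_extension N11 (@H2_d1_cont R u).
have hp t : 0 < h t by have [y yI ->] := hpos t; exact: upos'.
have [[c cI cmax] _] := max_abs_d1_attained u.
have up : forall x y : R, -1 <= x -> x < y -> y <= 1 ->
    Rintegral mu `]x, y[ p = h y - h x.
  move=> x y x1 xy y1.
  rewrite -(weak_derivative_FTC ch hu (H2_d1_L2 u) (@H2_fun_weak _ u) x1 xy y1).
  apply: eq_Rintegral => t; rewrite inE/= in_itv/= => /andP[xt ty]; apply: pd.
  by rewrite in_itv/= (le_trans x1 (ltW xt)) (le_trans (ltW ty) y1).
have he (x : R) : -1 <= x <= 1 -> h (- x) = h x.
  move=> /andP[x1 x2].
  have xI : x \in `[-1, 1] by rewrite in_itv/= x1.
  have nxI : - x \in `[-1, 1] by rewrite in_itv/= lerN2 x2/= lerNl.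
  by rewrite !hu// -ue.
have [h1 p1 pN1] : [/\ h 1 = alpha, p 1 = 0 & p (-1) = 0] by rewrite hu// !pd.
have Sc : S <= `|p c| by rewrite pd// cmax.
have [iF Fbound] := willmore_estimate ch cp hp (L2_integrable (H2_d2_L2 u))
  (proj2 (H2_d2_L2 u)) up
  (weak_derivative_FTC cp pd (H2_d2_L2 u) (@H2_d1_weak _ u))
  he h1 p1 pN1 S0 Sa cI Sc.
set F := (fun t => _ - _) in iF Fbound.
pose w (x : R) := (1 / (u x * Num.sqrt (1 + H2_d1 u x ^+ 2))
       - H2_d2 u x / (1 + H2_d1 u x ^+ 2) `^ (3 / 2)) ^+ 2
      * u x * Num.sqrt (1 + H2_d1 u x ^+ 2).
have FE (x : R) : x \in `]-1, 1[ -> w x = F x.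
  move=> xI; have xI' : x \in `[-1, 1] by exact: subset_itv_oo_cc xI.
  by rewrite /w willmore_integrandE ?upos'// /F hu// pd.
have mw : measurable_fun (`]-1, 1[%classic : set R) (EFin \o w).
  case/integrableP : iF => mF _; apply: eq_measurable_fun mF => x.
  by rewrite inE/= => xI; rewrite FE.
rewrite /W integral_itv_bndoo//.
have -> : (\int[mu]_(x in `](-1)%R, 1%R[) (w x)%:E =
    \int[mu]_(x in `](-1)%R, 1%R[) (F x)%:E)%E.
  by apply: eq_integral => x; rewrite inE/= => xI; rewrite FE.
(* Integrability of [F] makes the extended-real integral finite, so the comparison can be made in
   [R]. *)
rewrite -[X in (_ * X)%E]fineK; last exact: integrable_fin_num.
rewrite -EFinM lte_fin -/(Rintegral mu _ F).
have pi0 : 0 < pi :> R by exact: pi_gt0.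
have -> : pi * (alpha - S) * G S ^+ 2 = pi / 2 * (2 * (alpha - S) * G S ^+ 2)
  by field.
by rewrite ltr_pM2l// divr_gt0.
Qed.

End H2.

Theorem proposition3p4 (R : realType) (alpha S : R)
    (halpha : 0 < alpha) (hS : 0 < S) (hSalpha : S < alpha)
    (u : H2 R) (hu : N alpha u) :
  (S <= max_abs_d1 u -> ((pi * (alpha - S) * G S ^+ 2)%:E < W u)%E) /\
  ((W u <= (pi * (alpha - S) * G S ^+ 2)%:E)%E -> max_abs_d1 u < S).
Proof.
have main := willmore_lower_bound hu hS hSalpha.
split=> // WG; rewrite ltNge; apply/negP => /main.
by rewrite ltNge WG.
Qed.
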